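(* Let $\mathcal C\in\mathbb R^{d\times d}$ be a symmetric positive definite matrix, let $\tau$ be a Borel probability measure on the unit sphere $\mathbb S^{d-1}\subset\mathbb R^d$, and let $\pi_{\mathrm{gH\&R}}$ be the transition kernel of the generalized Hit-and-Run sampler with direction distribution $\tau$ and Gaussian target measure $\gamma^{\mathcal C}=\mathcal N(0,\mathcal C)$. Then $$\boldsymbol{\mathcal W}^2_{\mathcal C^{-1/2}}\bigl(\pi_{\mathrm{gH\&R}}(x,\cdot),\,\pi_{\mathrm{gH\&R}}(\tilde x,\cdot)\bigr)\ \leq\ (1-\rho)\,|x-\tilde x|_{\mathcal C^{-1/2}}\quad\text{for all }x,\tilde x\in\mathbb R^d,$$ where $$\rho\ =\ \frac12\inf_{|\zeta|=1}\mathbb E_{v\sim\tau}\Bigl(\zeta\cdot\frac{\mathcal C^{-1/2}v}{|\mathcal C^{-1/2}v|}\Bigr)^2 ,$$ the infimum being over unit vectors $\zeta\in\mathbb R^d$.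
   Context: For $x\in\mathbb R^d$ and $v\in\mathbb S^{d-1}$, let $\gamma^{\mathcal C}_{x,v}$ be the probability measure on $\mathbb R$ with density proportional to $h\mapsto\gamma^{\mathcal C}(x+hv)$, where $\gamma^{\mathcal C}(\cdot)$ denotes the Lebesgue density of $\mathcal N(0,\mathcal C)$; explicitly $\gamma^{\mathcal C}_{x,v}=\mathcal N\bigl(-\frac{x\cdot\mathcal C^{-1}v}{|\mathcal C^{-1/2}v|^2},\,|\mathcal C^{-1/2}v|^{-2}\bigr)$. The generalized Hit-and-Run kernel is $$\pi_{\mathrm{gH\&R}}(x,A)=\int_{\mathbb S^{d-1}}\int_{\mathbb R}1_A(x+hv)\,\gamma^{\mathcal C}_{x,v}(dh)\,\tau(dv)$$ for $x\in\mathbb R^d$ and measurable $A\subset\mathbb R^d$; that is, from $x$ one samples $v\sim\tau$, then $H\sim\gamma^{\mathcal C}_{x,v}$, and moves to $x+Hv$. Norms: $|\cdot|$ is the Euclidean norm and $|x|_{\mathcal C^{-1/2}}=|\mathcal C^{-1/2}x|$. $\boldsymbol{\mathcal W}^2_{\mathcal C^{-1/2}}$ is the $L^2$-Wasserstein distance with respect to the metric induced by $|\cdot|_{\mathcal C^{-1/2}}$: $\boldsymbol{\mathcal W}^2_{\mathcal C^{-1/2}}(\eta,\nu)=\inf\bigl(\mathbb E|X-\tilde X|^2_{\mathcal C^{-1/2}}\bigr)^{1/2}$ over all couplings $(X,\tilde X)$ of $\eta$ and $\nu$. *)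

(* Defs.v *)
From HB Require Import structures.
From mathcomp Require Import all_boot all_order all_algebra.
From mathcomp Require Import all_classical all_reals all_analysis.
From mathcomp Require Import measurable_realfun.

Set Implicit Arguments.
Unset Strict Implicit.
Unset Printing Implicit Defensive.
Import Order.TTheory GRing.Theory Num.Theory.
Import numFieldNormedType.Exports.

Local Open Scope classical_set_scope.
Local Open Scope ring_scope.

(* 'cV[R]_d with its Borel sigma-algebra. The library norm `|x| on column
   vectors is the sup norm, so the Euclidean norm is defined separately. *)
Notation borelV R d := (g_sigma_algebraType (@open 'cV[R]_d)).

Section euclidean.
Context {R : realType} {d : nat}.
Implicit Types (x y v : 'cV[R]_d) (A C S : 'M[R]_d).

Definition dotv x y : R := \sum_(i < d) x i 0 * y i 0.

Definition enorm x : R := Num.sqrt (dotv x x).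

Definition unit_sphere : set (borelV R d) := [set v | enorm v = 1].

Definition posdefmx A : Prop :=
  A^T = A /\ forall x, x != 0 -> 0 < dotv x (A *m x).

(* C^{-1/2}: for posdefmx C, the unique positive definite square root of
   C^{-1}; the default value 0 is only taken outside that case. *)
Definition invsqrtmx C : 'M[R]_d :=
  xget 0 [set S | posdefmx S /\ S *m S = invmx C].

(* |x|_S = |S x|; used with S = C^{-1/2}. *)
Definition mnorm S x : R := enorm (S *m x).

End euclidean.

Section wasserstein.
Context {R : realType} {d : nat}.
Local Notation V := (borelV R d).
Implicit Types (mu nu : set V -> \bar R).

(* P is the joint law of a pair (X, Y) with X ~ mu and Y ~ nu. The arguments
   mu, nu are plain set functions; unless they agree with probability measures
   on measurable sets there is no coupling, and W2 below is +oo. *)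
Definition coupling mu nu (P : probability (V * V)%type R) : Prop :=
  forall A : set V, measurable A ->
    P (A `*` [set: V]) = mu A /\ P ([set: V] `*` A) = nu A.

Definition W2 (S : 'M[R]_d) mu nu : \bar R :=
  sqrte (ereal_inf [set 'E_P[fun z : V * V => (mnorm S (z.1 - z.2) ^+ 2)%R]%E
                   | P in coupling mu nu]).

End wasserstein.

Section hit_and_run.
Context {R : realType} {d : nat}.
Local Notation V := (borelV R d).
Implicit Types (C : 'M[R]_d) (x v : 'cV[R]_d) (tau : probability V R).

Definition gauss_pdf C x : R :=
  expR (- (dotv x (invmx C *m x) / 2)) / Num.sqrt ((2 * pi) ^+ d * \det C).

Definition gauss_line C x v (A : set (measurableTypeR R)) : \bar R :=
  (\int[lebesgue_measure]_(h in A) (gauss_pdf C (x + h *: v))%:E)%E.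

Lemma gauss_pdf_ge0 C x : 0 <= gauss_pdf C x.
Proof. by rewrite divr_ge0 ?expR_ge0 ?sqrtr_ge0. Qed.

Lemma measurable_gauss_pdf_line C x v :
  measurable_fun [set: R] (fun h => gauss_pdf C (x + h *: v)).
Proof.
apply: measurable_funM => //; apply: measurableT_comp => //.
apply: measurableT_comp => //; apply: measurable_funM => //.
apply: measurable_sum => i.
have mcoord (M : 'M[R]_d) j :
    measurable_fun [set: R] (fun h => (M *m (x + h *: v)) j 0).
  under eq_fun do rewrite mulmxDr -scalemxAr !mxE.
  by apply: measurable_funD => //; apply: measurable_funM.
apply: measurable_funM; last exact: mcoord.
by under eq_fun do rewrite -[x + _]mul1mx; exact: mcoord.
Qed.

Section gauss_line_measure.
Variables (C : 'M[R]_d) (x v : 'cV[R]_d).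

Let gauss_line0 : gauss_line C x v set0 = 0%E.
Proof. exact: integral_set0. Qed.

Let gauss_line_ge0 A : (0 <= gauss_line C x v A)%E.
Proof. by apply: integral_ge0 => h _; rewrite lee_fin gauss_pdf_ge0. Qed.

Let gauss_line_sigma_additive : semi_sigma_additive (gauss_line C x v).
Proof.
apply: semi_sigma_additive_nng_induced => //.
- by apply/measurable_EFinP; exact: measurable_gauss_pdf_line.
- by move=> h; rewrite lee_fin gauss_pdf_ge0.
Qed.

HB.instance Definition _ := isMeasure.Build _ _ _ (gauss_line C x v)
  gauss_line0 gauss_line_ge0 gauss_line_sigma_additive.

End gauss_line_measure.

(* The probability on R with density proportional to
   h |-> gauss_pdf C (x + h *: v). For posdefmx C and v != 0 the total mass of
   gauss_line is positive and finite, so the Dirac default is not used. *)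
Definition gauss_cond C x v : probability (measurableTypeR R) R :=
  mnormalize (gauss_line C x v) (\d_(0 : measurableTypeR R)).

(* A probability tau on the sphere is represented as one on 'cV[R]_d giving
   mass 1 to unit_sphere. *)
Definition gHR_kernel C tau x (A : set V) : \bar R :=
  (\int[tau]_(v in unit_sphere)
     \int[gauss_cond C x v]_h (\1_A (x + h *: (v : 'cV[R]_d)))%:E)%E.

Definition gHR_rate C tau : R :=
  2^-1 * inf [set fine 'E_tau[fun v =>
                  (dotv z ((mnorm (invsqrtmx C) v)^-1 *: (invsqrtmx C *m v))
                    ^+ 2)%R]%E
             | z in unit_sphere].

End hit_and_run.

(* Main.v *)
Require Import Defs.
From HB Require Import structures.
From mathcomp Require Import all_boot all_order all_algebra.
From mathcomp Require Import all_classical all_reals all_analysis.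
From mathcomp Require Import measurable_realfun ring lra.
Set Implicit Arguments.
Unset Strict Implicit.
Unset Printing Implicit Defensive.
Import Order.TTheory GRing.Theory Num.Theory.
Import numFieldNormedType.Exports.
Local Open Scope classical_set_scope.
Local Open Scope ring_scope.

(* From both x and y take the same direction v ~ tau and the same standard
   normal variable Z: since the conditional laws on the lines x + Rv and y + Rv
   are normal with the same variance, the two moves differ only through their
   means. In the coordinates w = C^{-1/2} (x - y) and u = C^{-1/2} v normalized,
   the difference of the new positions is w - (w.u) u, of squared length
   |w|^2 - (w.u)^2. Averaging over v gives at most (1 - 2 rho) |w|^2, which is
   at most ((1 - rho) |w|)^2. *)

(** * Algebra of the Euclidean inner product *)

Section dotv_theory.
Context {R : realType} {d : nat}.
Implicit Types (x y z : 'cV[R]_d) (A : 'M[R]_d).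

Lemma dotvC x y : dotv x y = dotv y x.
Proof. by apply: eq_bigr => i _; rewrite mulrC. Qed.

Lemma dotvDl x y z : dotv (x + y) z = dotv x z + dotv y z.
Proof. by rewrite -big_split/=; apply: eq_bigr => i _; rewrite mxE mulrDl. Qed.

Lemma dotvZl a x y : dotv (a *: x) y = a * dotv x y.
Proof. by rewrite mulr_sumr; apply: eq_bigr => i _; rewrite mxE mulrA. Qed.

Lemma dotvDr x y z : dotv z (x + y) = dotv z x + dotv z y.
Proof. by rewrite dotvC dotvDl !(dotvC z). Qed.

Lemma dotvZr a x y : dotv x (a *: y) = a * dotv x y.
Proof. by rewrite dotvC dotvZl dotvC. Qed.

Lemma dotvNl x y : dotv (- x) y = - dotv x y.
Proof. by rewrite -scaleN1r dotvZl mulN1r. Qed.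

Lemma dotv0 x : dotv x 0 = 0.
Proof. by rewrite -(scale0r 0) dotvZr mul0r. Qed.

Lemma dotvv_ge0 x : 0 <= dotv x x.
Proof. by apply: sumr_ge0 => i _; rewrite -expr2 sqr_ge0. Qed.

Lemma dotvv_eq0 x : (dotv x x == 0) = (x == 0).
Proof.
apply/eqP/eqP => [/eqP|->]; last exact: dotv0.
rewrite psumr_eq0 => [/allP x0|i _]; last by rewrite -expr2 sqr_ge0.
apply/colP => i; have := x0 i (mem_index_enum i).
by rewrite -expr2 sqrf_eq0 mxE => /eqP.
Qed.

Lemma sqr_enorm x : enorm x ^+ 2 = dotv x x.
Proof. by rewrite sqr_sqrtr// dotvv_ge0. Qed.

Lemma dotv_mulmx_sym A x y : A^T = A -> dotv (A *m x) y = dotv x (A *m y).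
Proof.
move=> AT.
have dotvE u v : dotv u v = (u^T *m v) 0 0.
  by rewrite mxE; apply: eq_bigr => i _; rewrite mxE.
by rewrite !dotvE trmx_mul AT mulmxA.
Qed.

End dotv_theory.

(** * Positive definite matrices: determinant and inverse *)

Section posdefmx_theory.
Context {R : realType} {d : nat}.
Implicit Types C : 'M[R]_d.

(** A row vector killed by [C] transposes, by symmetry, to a nonzero vector on which the quadratic
    form vanishes. *)
Lemma posdefmx_det_neq0 C : posdefmx C -> \det C != 0.
Proof.
move=> [CT Cpos]; apply/eqP => /eqP/det0P[v v0 vC].
have := Cpos v^T; rewrite -{1}CT -trmx_mul vC trmx0 dotv0 ltxx.
by rewrite (can2_eq (@trmxK _ _ _) (@trmxK _ _ _)) trmx0 => /(_ v0).
Qed.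

Lemma posdefmx_convex C t : posdefmx C -> t \in `[0, 1] ->
  posdefmx (t%:M + (1 - t) *: C).
Proof.
move=> [CT Cpos]; rewrite in_itv/= => /andP[t0 t1]; split.
  by rewrite raddfD/= tr_scalar_mx linearZ/= CT.
move=> x x0; rewrite mulmxDl mul_scalar_mx -scalemxAl dotvDr !dotvZr.
have xx : 0 < dotv x x by rewrite lt_def dotvv_eq0 x0 dotvv_ge0.
(* At [t = 1] strict positivity comes from the identity part, for [t < 1] from the part with [C]. *)
have := Cpos x x0; have [->|t1'] := eqVneq t 1; first lra.
have {}t1 : t < 1 by rewrite lt_neqAle t1'.
by move=> xC; rewrite ltr_wpDl ?mulr_ge0 ?mulr_gt0 ?subr_gt0 // ltW.
Qed.

(* Along the segment from C to the identity the determinant is polynomial and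
   never vanishes, hence keeps the sign it has at the identity. *)
Lemma posdefmx_det_gt0 C : posdefmx C -> 0 < \det C.
Proof.
move=> Cpos.
pose p : {poly R} := \det ('X%:M + (1 - 'X) *: map_mx polyC C).
have pE t : p.[t] = \det (t%:M + (1 - t) *: C).
  rewrite -horner_evalE -det_map_mx; congr (\det _).
  by apply/matrixP => i j; rewrite !mxE /= horner_evalE !hornerE hornerMn hornerX.
have p0 : p.[0] = \det C by rewrite pE subr0 scale1r -scalemx1 scale0r add0r.
have p1 : p.[1] = 1 by rewrite pE subrr scale0r addr0 det1.
rewrite ltNge; apply/negP => C0.
have [||t t01 /rootP pt] := @poly_ivt R p 0 1 => //.
  by rewrite p0 C0 p1 ler01.
by move/posdefmx_det_neq0: (posdefmx_convex Cpos t01); rewrite -pE pt eqxx.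
Qed.

Lemma posdefmx_unit C : posdefmx C -> C \in unitmx.
Proof. by move=> /posdefmx_det_gt0 C0; rewrite unitmxE unitfE gt_eqF. Qed.

(** Writing [x = C *m y] turns the quadratic form of the inverse at [x] into that of [C] at [y]. *)
Lemma posdefmx_inv C : posdefmx C -> posdefmx (invmx C).
Proof.
move=> Cpos; have Cu := posdefmx_unit Cpos; case: (Cpos) => CT C0.
split => [|x x0]; first by rewrite trmx_inv CT.
rewrite -{1}[x](mulKVmx Cu) dotv_mulmx_sym//.
apply: C0; apply: contraNneq x0 => Cx.
by rewrite -[x](mulKVmx Cu) Cx mulmx0.
Qed.

End posdefmx_theory.

(** * Borel measurability of vector-valued maps *)

Section borelV_measurability.
Context {R : realType} {d : nat}.

Lemma measurable_coordv (i : 'I_d) :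
  measurable_fun [set: borelV R d] (fun v : borelV R d => v i 0).
Proof.
apply: (measurability _ (RGenOInfty.measurableE R)) => _ [_ [a ->] <-]; rewrite setTI; apply: sub_sigma_algebra.
apply: open_comp => [v _|]; first exact: coord_continuous.
exact: interval_open.
Qed.

(* An open set is the union of the rational boxes that it contains. *)
Lemma measurable_funvP d' (T : measurableType d') (f : T -> borelV R d) :
  (forall i, measurable_fun [set: T] (fun t => f t i 0)) ->
  measurable_fun [set: T] f.
Proof.
move=> mf; apply: (@measurability _ _ _ (borelV R d) _ _ (@open 'cV[R]_d) erefl) => _ [U oU <-].
rewrite setTI.
pose box (k : 'cV[rat]_d * rat) : set 'cV[R]_d :=
  [set v | forall i, `|ratr (k.1 i 0) - v i 0| < ratr k.2].
(* Boxes not inside [U] contribute the empty set, so the union runs over the whole countable index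
   type. *)
pose F k : set T := if `[< box k `<=` U >] then f @^-1` box k else set0.
have -> : f @^-1` U = \bigcup_k F k.
  apply/seteqP; split => [t Uft|t [k _]]; last first.
    by rewrite /F; case: asboolP => // kU; exact: kU.
  have [e/= e0 eU] : nbhs_ball (f t : 'cV[R]_d) U.
    by apply/nbhs_ballP; exact: open_nbhs_nbhs.
  (* With [r < e / 2], every point of a box of radius [r] containing [f t] is within [e] of
     [f t]. *)
  have [r] := rat_in_itvoo (divr_gt0 e0 (ltr0Sn _ 1)).
  rewrite in_itv/= => /andP[r0 re].
  have /choice[c cP] i : exists c : rat, `|ratr c - f t i 0| < ratr r.
    have [c] := rat_in_itvoo (ltr_pwDr r0 (lexx (f t i 0))).
    rewrite in_itv/= => /andP[c1 c2]; exists c.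
    by rewrite ltr_distl; apply/andP; split; lra.
  exists (\col_i c i, r) => //; rewrite /F; case: asboolP => [_ i|].
    by rewrite /= mxE.
  case=> v /= vr; apply: eU; split => // i j; rewrite ord1.
  have := vr i; rewrite mxE => {}vr; have {}cP := cP i.
  have := ler_distD (ratr (c i)) (f t i 0) (v i 0).
  by rewrite /ball/= (distrC (f t i 0) (ratr _)); lra.
apply: countable_bigcupT_measurable => // k; rewrite /F; case: ifP => // _.
have -> : f @^-1` box k =
    \bigcap_(i in [set: 'I_d]) [set t | `|ratr (k.1 i 0) - f t i 0| < ratr k.2].
  by apply/seteqP; split => [t tk i _|t tk i]; [exact: tk|exact: (tk i)].
apply: fin_bigcap_measurable => [|i _]; first exact: finite_finset.
rewrite -[X in measurable X]setTI.
apply: (measurable_fun_ltr (g := cst (ratr k.2)) _ _ measurableT) => //=.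
apply: measurableT_comp => //.
by apply: measurable_funB => //; exact: measurable_cst.
Qed.

End borelV_measurability.

(** * Affine changes of variable for Lebesgue and normal measures *)

Section normal_affine.
Context {R : realType}.
Implicit Types m s : R.
Local Notation mu := (@lebesgue_measure R).

Lemma measurable_fun_affine m s :
  measurable_fun [set: R] (fun z : R => m + s * z).
Proof. by apply: measurable_funD => //; exact: measurable_funM. Qed.

(** Lebesgue measure is determined by half-open intervals, where the identity compares lengths. *)
Lemma lebesgue_measure_affine m s (A : set R) : 0 < s -> measurable A ->
  (mu A = s%:E * mu ((fun z => m + s * z)%R @^-1` A))%E.
Proof.
move=> s0 mA.
pose f z : measurableTypeR R := m + s * z.
have mf : measurable_fun [set: measurableTypeR R] f by exact: measurable_fun_affine.
pose nu :=
  mscale (NngNum (ltW s0)) (pushforward mu f : {measure set (measurableTypeR R) -> \bar R}).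
rewrite (@lebesgue_measure_unique _ (nu mf))// => _ [[a b] _ <-].
rewrite /nu/= /mscale/= /pushforward.
have -> : f @^-1` `]a, b] = `](a - m) / s, (b - m) / s]%classic.
  apply/seteqP; split => z; rewrite /f/= !in_itv/= ltr_pdivrMr// ler_pdivlMr//;
    rewrite (mulrC z) => /andP[? ?]; apply/andP; split; lra.
rewrite !lebesgue_measure_itv/= !lte_fin ltr_pM2r ?invr_gt0// ltrD2r.
case: ifPn => _; last by rewrite mule0.
by rewrite -!EFinB -EFinM; congr EFin; field; exact: lt0r_neq0.
Qed.

(** Lets one standard normal variable drive every line. The change of variables produces a factor
    [s], which cancels against the peak of the density. *)
Lemma normal_prob_affine m s (A : set R) : 0 < s -> measurable A ->
  normal_prob m s A = normal_prob 0 1 ((fun z => m + s * z) @^-1` A).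
Proof.
move=> s0 mA; rewrite /normal_prob.
pose f z : measurableTypeR R := m + s * z.
have mf : measurable_fun [set: measurableTypeR R] f by exact: measurable_fun_affine.
pose nu :=
  mscale (NngNum (ltW s0)) (pushforward mu f : {measure set (measurableTypeR R) -> \bar R}).
have mpdf m' s' D : measurable_fun D (EFin \o normal_pdf m' s').
  by apply/measurable_EFinP; apply: measurable_funTS; exact: measurable_normal_pdf.
rewrite (@eq_measure_integral _ _ _ _ (nu mf)) => [|B mB _]; last first.
  exact: lebesgue_measure_affine.
have pdf0 m' s' z : (0 <= (normal_pdf m' s' z)%:E)%E.
  by rewrite lee_fin normal_pdf_ge0.
have mfA : measurable (f @^-1` A) by rewrite -[X in measurable X]setTI; exact: mf.
rewrite ge0_integral_mscale//=; last exact: mpdf.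
rewrite ge0_integral_pushforward//; last exact: mpdf.
rewrite -ge0_integralZl//; first last.
- by rewrite lee_fin ltW.
- by move=> z _; exact: pdf0.
- apply: (measurableT_comp (mpdf m s setT)); exact: measurable_funTS.
apply: eq_integral => z _; rewrite /= -EFinM /f; congr EFin.
rewrite !normal_pdfE ?oner_eq0 ?gt_eqF// /normal_peak /normal_fun.
rewrite -mulrnAr sqrtrM ?sqr_ge0// sqrtr_sqr gtr0_norm// expr1n mul1r.
rewrite invfM !mulrA mulfV ?gt_eqF// mul1r; congr (_ * expR _).
by rewrite subr0; field; rewrite gt_eqF.
Qed.

End normal_affine.

(** * The conditional Gaussian law on a line *)

Lemma mnormalizeE d (T : measurableType d) (R : realType)
    (mu : {measure set T -> \bar R}) (P : probability T R) (K : R) (A : set T) :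
  0 < K -> mu [set: T] = K%:E -> mnormalize mu P A = (mu A * K^-1%:E)%E.
Proof. by move=> K0 muT; rewrite /mnormalize muT eqe gt_eqF. Qed.

Section conditional_on_line.
Context {R : realType} {d : nat}.
Variable C : 'M[R]_d.
Hypothesis C_posdef : posdefmx C.
Implicit Types x v : 'cV[R]_d.

(* Equal to 0 at v = 0, so that the identities involving its square also hold
   there; as a power function it is measurable in v. *)
Definition line_sd v : R := dotv v (invmx C *m v) `^ (- 2^-1).

(** For [v != 0], the minimizer in [h] of the quadratic form of [invmx C] at [x + h *: v]. *)
Definition line_mean x v : R := - dotv x (invmx C *m v) * line_sd v ^+ 2.

Lemma dotv_inv_ge0 v : 0 <= dotv v (invmx C *m v).
Proof.
have [->|/(posdefmx_inv C_posdef).2/ltW//] := eqVneq v 0.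
by rewrite mulmx0 dotv0.
Qed.

Lemma line_sd_gt0 v : v != 0 -> 0 < line_sd v.
Proof. by move=> v0; rewrite powR_gt0//; exact: (posdefmx_inv C_posdef).2. Qed.

Lemma sqr_line_sd v : line_sd v ^+ 2 = (dotv v (invmx C *m v))^-1.
Proof.
by rewrite /line_sd powRN powR12_sqrt ?dotv_inv_ge0// exprVn sqr_sqrtr// dotv_inv_ge0.
Qed.

(** Completing the square in [h]. Only the positivity of [K] matters later, since normalization
    removes it. *)
Lemma gauss_pdf_line x v : v != 0 -> exists2 K : R, 0 < K &
  forall h, gauss_pdf C (x + h *: v) = K * normal_pdf (line_mean x v) (line_sd v) h.
Proof.
move=> v0; have s0 := line_sd_gt0 v0.
have q0 := (posdefmx_inv C_posdef).2 v v0.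
pose q := dotv v (invmx C *m v); pose b := dotv x (invmx C *m v).
(* The exponential is taken at the minimizer on the line; dividing by [normal_peak] undoes the
   normalization of [normal_pdf]. *)
exists (expR (- (dotv x (invmx C *m x) - b ^+ 2 / q) / 2) /
        Num.sqrt ((2 * pi) ^+ d * \det C) / normal_peak (line_sd v)).
  rewrite !divr_gt0 ?expR_gt0// ?normal_peak_gt0 ?gt_eqF// sqrtr_gt0.
  by rewrite mulr_gt0 ?exprn_gt0 ?mulr_gt0 ?pi_gt0// posdefmx_det_gt0.
move=> h; rewrite normal_pdfE ?gt_eqF// /normal_fun /gauss_pdf.
set N := Num.sqrt _; rewrite -!mulrA mulKf ?gt_eqF ?normal_peak_gt0 ?gt_eqF//.
rewrite mulrCA -expRD mulrC; congr (_ * expR _).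
rewrite /line_mean sqr_line_sd mulmxDr -scalemxAr !dotvDl !dotvDr !dotvZl !dotvZr.
rewrite (dotvC v (_ *m x)) dotv_mulmx_sym ?(posdefmx_inv C_posdef).1//.
by rewrite -/b -/q; field; rewrite gt_eqF.
Qed.

(** The line measure is [K] times a probability, so its total mass is [K], which is positive and
    cancels. *)
Lemma gauss_condE x v (A : set R) : v != 0 -> measurable A ->
  gauss_cond C x v A = normal_prob (line_mean x v) (line_sd v) A.
Proof.
move=> v0 mA; have [K K0 KE] := gauss_pdf_line x v0.
have lineE B : measurable B ->
    gauss_line C x v B = (K%:E * normal_prob (line_mean x v) (line_sd v) B)%E.
  move=> mB; rewrite -ge0_integralZl//.
  - by apply: eq_integral => h _; rewrite KE.
  - apply/measurable_EFinP; apply: measurable_funTS.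
    exact: measurable_normal_pdf.
  - by move=> h _; rewrite lee_fin normal_pdf_ge0.
  - by rewrite lee_fin ltW.
transitivity (gauss_line C x v A * (K^-1)%:E)%E.
  apply: mnormalizeE => //.
  by apply: etrans (lineE setT measurableT) _; rewrite probability_setT mule1.
by rewrite lineE// muleAC -EFinM divff ?gt_eqF// mul1e.
Qed.

End conditional_on_line.

(** * The product of two probabilities as a probability *)

Section product_probability.
Context d1 d2 (T1 : measurableType d1) (T2 : measurableType d2) (R : realType).
Variables (P : probability T1 R) (Q : probability T2 R).

Let product_setT : (P \x Q)%E [set: T1 * T2] = 1%E.
Proof.
rewrite -setXTT product_measure1E//.
by rewrite [X in (X * _)%E]probability_setT [X in (_ * X)%E]probability_setT mule1.
Qed.

HB.instance Definition _ := Measure.on (P \x Q)%E.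
HB.instance Definition _ :=
  Measure_isProbability.Build _ _ _ (P \x Q)%E product_setT.

Definition product_probability : probability (T1 * T2)%type R := (P \x Q)%E.

End product_probability.

(** * The synchronous coupling of two moves *)

Section synchronous_coupling.
Context {R : realType} {d : nat}.
Local Notation V := (borelV R d).
Variables (C : 'M[R]_d) (tau : probability V R).
Hypothesis C_posdef : posdefmx C.
Hypothesis tau_sphere : tau unit_sphere = 1%E.
Implicit Types x y : 'cV[R]_d.
Local Notation noise := (normal_prob 0 1 : probability (measurableTypeR R) R).

Lemma measurable_dotv_mulmx d' (T : measurableType d') (A B : 'M[R]_d)
    (f g : T -> V) :
  measurable_fun [set: T] f -> measurable_fun [set: T] g ->
  measurable_fun [set: T] (fun t => dotv (A *m f t) (B *m g t)).
Proof.
move=> mf mg.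
have mcoord (M : 'M[R]_d) (h : T -> V) i : measurable_fun [set: T] h ->
    measurable_fun [set: T] (fun t => (M *m h t) i 0).
  move=> mh; under eq_fun do rewrite mxE.
  apply: measurable_sum => j; apply: measurable_funM => //.
  exact: (measurableT_comp (measurable_coordv j)).
by apply: measurable_sum => i; apply: measurable_funM; exact: mcoord.
Qed.

Lemma measurable_dotv d' (T : measurableType d') (f g : T -> V) :
  measurable_fun [set: T] f -> measurable_fun [set: T] g ->
  measurable_fun [set: T] (fun t => dotv (f t) (g t)).
Proof.
move=> mf mg; have := measurable_dotv_mulmx 1%:M 1%:M mf mg.
by under eq_fun do rewrite !mul1mx.
Qed.

Lemma measurable_unit_sphere : measurable (unit_sphere : set V).
Proof.
have -> : (unit_sphere : set V) = (fun v : V => dotv v v) @^-1` [set 1].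
  apply/seteqP; split => v /= [v1]; last by rewrite /unit_sphere/= /enorm v1 sqrtr1.
  by rewrite -sqr_enorm v1 expr1n.
rewrite -[X in measurable X]setTI.
have mid : measurable_fun [set: V] (fun v : V => v) by exact: measurable_id.
by apply: (measurable_dotv mid mid).
Qed.

(** The complement of the sphere is [tau]-null. This reconciles the kernel, integrated over the
    sphere, with a product measure on the whole space. *)
Lemma integral_unit_sphere (f : V -> \bar R) :
  measurable_fun [set: V] f -> (forall v, 0 <= f v)%E ->
  (\int[tau]_(v in unit_sphere) f v = \int[tau]_v f v)%E.
Proof.
move=> mf f0; have mS := measurable_unit_sphere.
rewrite [RHS](ge0_negligible_integral (measurableC mS))//.
  by rewrite setTD setCK.
by apply: etrans (probability_setC _ mS) _; rewrite tau_sphere subee.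
Qed.

(** A move as a function of its randomness: [p.1] is the direction, [p.2] the standard normal value.
    Two starting points can thus share the same [p]. *)
Definition hr_step x (p : V * measurableTypeR R) : V :=
  x + (line_mean C x p.1 + line_sd C p.1 * p.2) *: (p.1 : 'cV[R]_d).

Lemma measurable_hr_step x : measurable_fun setT (hr_step x).
Proof.
have m1 : measurable_fun setT (fun p : V * measurableTypeR R => p.1).
  exact: measurable_fst.
have msd : measurable_fun setT (fun p : V * measurableTypeR R => line_sd C p.1).
  apply: (measurableT_comp (measurable_powR _)).
  have := measurable_dotv_mulmx 1%:M (invmx C) m1 m1.
  by under eq_fun do rewrite mul1mx.
apply: measurable_funvP => i.
under eq_fun do rewrite !mxE.
apply: measurable_funD => //; apply: measurable_funM; last first.
  exact: (measurableT_comp (measurable_coordv i)).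
apply: measurable_funD; last by apply: measurable_funM.
apply: measurable_funM; last exact: measurable_funX.
apply: measurableT_comp => //.
have mx : measurable_fun setT (fun p : V * measurableTypeR R => (x : V)) by [].
have := measurable_dotv_mulmx 1%:M (invmx C) mx m1.
by under eq_fun do rewrite mul1mx.
Qed.

(** Compared direction by direction: for a unit [v] the conditional law is normal, hence the affine
    image of the noise used in [hr_step]. *)
Lemma gHR_kernelE x (A : set V) : measurable A ->
  gHR_kernel C tau x A = (tau \x noise)%E (hr_step x @^-1` A).
Proof.
move=> mA; have mE : measurable (hr_step x @^-1` A).
  by rewrite -[X in measurable X]setTI; exact: measurable_hr_step.
rewrite /gHR_kernel /product_measure1 -[RHS]integral_unit_sphere//; last first.
  exact: measurable_fun_xsection.
apply: eq_integral => v /set_mem v1.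
have v0 : (v : 'cV[R]_d) != 0.
  apply/eqP => v0; move: v1; rewrite /unit_sphere/= /enorm v0 dotv0 sqrtr0.
  by move/eqP; rewrite eq_sym oner_eq0.
pose l (h : measurableTypeR R) : V := x + h *: (v : 'cV[R]_d).
have ml : measurable_fun setT l.
  apply: measurable_funvP => i; under eq_fun do rewrite !mxE.
  by apply: measurable_funD => //; exact: measurable_funM.
have mlA : measurable (l @^-1` A) by rewrite -[X in measurable X]setTI; exact: ml.
transitivity (gauss_cond C x v (l @^-1` A)).
  by rewrite -[in RHS](setIT (l @^-1` A)) -integral_indic.
rewrite gauss_condE// normal_prob_affine//; last exact: line_sd_gt0.
by congr (normal_prob _ _ _); apply/seteqP; split => z; rewrite /xsection/= inE.
Qed.

Definition hr_coupling_map x y (p : V * measurableTypeR R) : V * V :=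
  (hr_step x p, hr_step y p).

Lemma measurable_hr_coupling_map x y :
  measurable_fun setT (hr_coupling_map x y).
Proof. by apply: measurable_fun_pair; exact: measurable_hr_step. Qed.

HB.instance Definition _ x y := isMeasurableFun.Build _ _ _ _
  (hr_coupling_map x y) (measurable_hr_coupling_map x y).

Definition hr_coupling x y : probability (V * V)%type R :=
  distribution (product_probability tau noise) (hr_coupling_map x y).

Lemma hr_couplingP x y :
  coupling (gHR_kernel C tau x) (gHR_kernel C tau y) (hr_coupling x y).
Proof.
by move=> A mA; rewrite !gHR_kernelE//; split; congr ((tau \x noise)%E _);
  apply/seteqP; split => [p []|].
Qed.

(** A cost that depends on the direction alone lets Tonelli integrate out the normal variable. *)
Lemma expectation_hr_coupling x y (f : V * V -> R) (g : V -> R) :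
  measurable_fun [set: V * V] f -> measurable_fun [set: V] g ->
  (forall z, 0 <= f z) ->
  (forall p, f (hr_step x p, hr_step y p) = g p.1) ->
  ('E_(hr_coupling x y)[f] = \int[tau]_v (g v)%:E)%E.
Proof.
move=> mf mg f0 fg.
rewrite unlock ge0_integral_pushforward//; first last.
- by move=> z _; rewrite lee_fin.
- exact/measurable_EFinP.
rewrite preimage_setT (eq_integral (fun p => (g p.1)%:E)); last first.
  by move=> p _; rewrite /= fg.
rewrite fubini_tonelli1//=; first last.
- by move=> p; rewrite -fg lee_fin.
- by apply/measurable_EFinP; exact: measurableT_comp.
apply: eq_integral => v _; rewrite /fubini_F/=.
by rewrite integral_cst// [X in (_ * X)%E]probability_setT mule1.
Qed.

End synchronous_coupling.

(* Covering the default value S = 0, for which the contraction is an equality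
   of zeros, makes the existence of a square root of C^{-1} unnecessary. *)
Lemma invsqrtmxP (R : realType) (d : nat) (C : 'M[R]_d) :
  (invsqrtmx C)^T = invsqrtmx C /\ invsqrtmx C *m invsqrtmx C = invmx C \/
  invsqrtmx C = 0.
Proof.
by rewrite /invsqrtmx; case: xgetP => [S -> [[ST _] SS]|_]; [left|right].
Qed.

(** * The contraction estimate *)

Section contraction.
Context {R : realType} {d : nat}.
Local Notation V := (borelV R d).
Variables (C : 'M[R]_d) (tau : probability V R).
Hypothesis C_posdef : posdefmx C.
Hypothesis tau_sphere : tau unit_sphere = 1%E.
Implicit Types x y z v w : 'cV[R]_d.
Local Notation S := (invsqrtmx C).
Local Notation dir v := ((mnorm S v)^-1 *: (S *m v)).

(** Removes the square root hidden in [mnorm], for the algebra and for measurability. *)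
Lemma sqr_dotv_dir z v :
  dotv z (dir v) ^+ 2 = (dotv (S *m v) (S *m v))^-1 * dotv z (S *m v) ^+ 2.
Proof. by rewrite dotvZr exprMn exprVn /mnorm sqr_enorm. Qed.

Lemma sqr_mnorm_hr_step x y p :
  mnorm S (hr_step C x p - hr_step C y p) ^+ 2 =
  dotv (S *m (x - y)) (S *m (x - y)) - dotv (S *m (x - y)) (dir p.1) ^+ 2.
Proof.
rewrite sqr_dotv_dir /mnorm sqr_enorm /hr_step.
case: p => v h /=.
have [[ST SS]|->] := invsqrtmxP C; last by rewrite !mul0mx !dotv0 mulrC expr0n mul0r subr0.
have dotvS a b : dotv (S *m a) (S *m b) = dotv a (invmx C *m b).
  by rewrite dotv_mulmx_sym// mulmxA SS.
(* The shared normal term cancels; the means differ by the coefficient of the projection of [x - y]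
   on [v] for the form [invmx C]. *)
have -> : x + (line_mean C x v + line_sd C v * h) *: (v : 'cV[R]_d) -
          (y + (line_mean C y v + line_sd C v * h) *: (v : 'cV[R]_d)) =
    (x - y) - (dotv (x - y) (invmx C *m v) / dotv v (invmx C *m v)) *: v.
  rewrite /line_mean (sqr_line_sd C_posdef) dotvDl dotvNl opprD addrACA -scalerBl.
  by congr (_ + _); rewrite -scaleNr; congr (_ *: _); ring.
rewrite mulmxBr -scalemxAr; set w := S *m (x - y); set u := S *m v.
rewrite -!dotvS -/w -/u -scaleNr dotvDl !dotvDr !dotvZl !dotvZr (dotvC u w).
(* At [u = 0] each term containing [u] vanishes, whatever the value of the inverse. *)
have [->|u0] := eqVneq u 0; first by rewrite !dotv0; ring.
by field; rewrite dotvv_eq0.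
Qed.

Lemma measurable_sqr_dotv_dir z :
  measurable_fun [set: V] (fun v : V => dotv z (dir v) ^+ 2).
Proof.
under eq_fun do rewrite sqr_dotv_dir.
have mid : measurable_fun [set: V] (fun v : V => v) by exact: measurable_id.
apply: measurable_funM; last first.
  apply: measurable_funX.
  have := measurable_dotv_mulmx 1%:M S (measurable_cst (z : V)) mid.
  by under eq_fun do rewrite mul1mx.
(* Inversion becomes the power [-1], measurable on the whole line. *)
under eq_fun do rewrite -powR_inv1 ?dotvv_ge0//.
apply: (measurableT_comp (measurable_powR _)).
exact: (measurable_dotv_mulmx S S mid mid).
Qed.

Lemma measurable_sqr_mnorm_sub :
  measurable_fun [set: V * V] (fun z : V * V => mnorm S (z.1 - z.2) ^+ 2).
Proof.
under eq_fun do rewrite /mnorm sqr_enorm.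
have msub : measurable_fun [set: V * V] (fun z : V * V => (z.1 - z.2 : V)).
  apply: measurable_funvP => i; under eq_fun do rewrite !mxE.
  by apply: measurable_funB; apply: (measurableT_comp (measurable_coordv i)).
exact: (measurable_dotv_mulmx S S msub msub).
Qed.

(** By homogeneity [w] may be scaled to a unit vector, whose integral is one of the values in the
    infimum. *)
Lemma integral_sqr_dotv_dir_ge w :
  ((2 * gHR_rate C tau * dotv w w)%:E <= \int[tau]_v (dotv w (dir v) ^+ 2)%:E)%E.
Proof.
have h0 z : (0 <= \int[tau]_v (dotv z (dir v) ^+ 2)%:E)%E.
  by apply: integral_ge0 => v _; rewrite lee_fin sqr_ge0.
have [->|w0] := eqVneq w 0; first by rewrite dotv0 mulr0.
have ww0 : 0 < dotv w w by rewrite lt_def dotvv_eq0 w0 dotvv_ge0.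
rewrite /gHR_rate mulVKf//.
set E := [set fine _ | z in _].
pose z := (enorm w)^-1 *: w.
have z1 : (unit_sphere : set V) z.
  rewrite /unit_sphere/= /enorm dotvZl dotvZr mulrA -invfM -expr2 sqr_enorm.
  by rewrite mulVf ?gt_eqF// sqrtr1.
have Ez : (\int[tau]_v (dotv z (dir v) ^+ 2)%:E =
    (dotv w w)^-1%:E * \int[tau]_v (dotv w (dir v) ^+ 2)%:E)%E.
  rewrite -ge0_integralZl//.
  - apply: eq_integral => v _; rewrite -EFinM; congr EFin.
    by rewrite /z dotvZl exprMn exprVn sqr_enorm.
  - by apply/measurable_EFinP; exact: measurable_sqr_dotv_dir.
  - by move=> v _; rewrite lee_fin sqr_ge0.
  - by rewrite lee_fin invr_ge0 dotvv_ge0.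
have infE : inf E <= fine (\int[tau]_v (dotv z (dir v) ^+ 2)%:E)%E.
  apply: ge_inf; last by exists z => //; rewrite unlock.
  by exists 0 => _ [z' _ <-]; rewrite unlock fine_ge0.
move: (h0 w) infE; rewrite Ez.
(* [fine] is faithful only for a finite integral; if it is infinite the bound is immediate. *)
case: (\int[tau]_v _)%E => [r _|_ _|//]; last by rewrite leey.
by rewrite /= lee_fin mulrC ler_pdivlMr.
Qed.

(** Cauchy-Schwarz, read off from the squared distance after a move with normal value [0]. *)
Lemma sqr_dotv_dir_le x y v :
  dotv (S *m (x - y)) (dir v) ^+ 2 <= dotv (S *m (x - y)) (S *m (x - y)).
Proof. by rewrite -subr_ge0 -(sqr_mnorm_hr_step x y (v, 0)) sqr_ge0. Qed.

Lemma integral_sqr_mnorm_hr_step_le x y :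
  (\int[tau]_v (dotv (S *m (x - y)) (S *m (x - y)) -
                dotv (S *m (x - y)) (dir v) ^+ 2)%:E <=
   (((1 - gHR_rate C tau) * mnorm S (x - y)) ^+ 2)%:E)%E.
Proof.
rewrite /mnorm; have := sqr_dotv_dir_le x y; set w := S *m (x - y) => wle.
have g0 v : 0 <= dotv w w - dotv w (dir v) ^+ 2 by rewrite subr_ge0.
have mh := measurable_sqr_dotv_dir w.
(* Adding the integrals avoids extended subtraction; their finite sum forces both to be finite. *)
have : (\int[tau]_v (dotv w w - dotv w (dir v) ^+ 2)%:E +
        \int[tau]_v (dotv w (dir v) ^+ 2)%:E = (dotv w w)%:E)%E.
  rewrite -ge0_integralD//.
  - under eq_integral do rewrite -EFinD subrK.
    by rewrite integral_cst// [X in (_ * X)%E]probability_setT mule1.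
  - by move=> v _; rewrite lee_fin.
  - by apply/measurable_EFinP; exact: measurable_funB.
  - by move=> v _; rewrite lee_fin sqr_ge0.
  - exact/measurable_EFinP.
have : (0 <= \int[tau]_v (dotv w w - dotv w (dir v) ^+ 2)%:E)%E.
  by apply: integral_ge0 => v _; rewrite lee_fin.
have := integral_sqr_dotv_dir_ge w.
move: (\int[tau]_v _)%E (\int[tau]_v _)%E => [b||] [a||]//.
rewrite !lee_fin exprMn sqr_enorm -EFinD => rb a0 [ab].
(* 1 - 2 rho <= (1 - rho)^2 *)
apply: (@le_trans _ _ ((1 - 2 * gHR_rate C tau) * dotv w w)); first lra.
rewrite ler_wpM2r ?dotvv_ge0//.
by have := sqr_ge0 (gHR_rate C tau); lra.
Qed.

(** If [w] is nonzero, the mean squared projection is at most [dotv w w], so the rate is at most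
    1/2. The sign allows passing to squares in the final bound. *)
Lemma gHR_factor_ge0 x y : 0 <= (1 - gHR_rate C tau) * mnorm S (x - y).
Proof.
rewrite /mnorm; have := sqr_dotv_dir_le x y; set w := S *m (x - y) => wle.
have [->|w0] := eqVneq w 0; first by rewrite /enorm dotv0 sqrtr0 mulr0.
have ww0 : 0 < dotv w w by rewrite lt_def dotvv_eq0 w0 dotvv_ge0.
rewrite mulr_ge0 ?sqrtr_ge0//.
have : ((2 * gHR_rate C tau * dotv w w)%:E <= (dotv w w)%:E)%E.
  apply: le_trans (integral_sqr_dotv_dir_ge w) _.
  rewrite -[leRHS](_ : \int[tau]_v (dotv w w)%:E = _)%E; last first.
    by rewrite integral_cst// [X in (_ * X)%E]probability_setT mule1.
  apply: ge0_le_integral => //.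
  - by move=> v _; rewrite lee_fin sqr_ge0.
  - by apply/measurable_EFinP; exact: measurable_sqr_dotv_dir.
  - by move=> v _; rewrite lee_fin.
by rewrite lee_fin ger_pMl//; lra.
Qed.

End contraction.

Theorem lemma2 (R : realType) (d : nat) (C : 'M[R]_d)
    (tau : probability (borelV R d) R)
    (C_posdef : posdefmx C)
    (tau_sphere : tau unit_sphere = 1%E)
    (x y : 'cV[R]_d) :
  (W2 (invsqrtmx C) (gHR_kernel C tau x) (gHR_kernel C tau y)
     <= ((1 - gHR_rate C tau) * mnorm (invsqrtmx C) (x - y))%:E)%E.
Proof.
rewrite -(ger0_norm (gHR_factor_ge0 tau C_posdef x y)) -sqrtr_sqr.
rewrite -[leRHS]/(sqrte (_ ^+ 2)%:E) /W2 lee_sqrt ?lee_fin ?sqr_ge0//.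
apply: le_trans (integral_sqr_mnorm_hr_step_le tau C_posdef x y).
(* The infimum over couplings is at most the cost of the synchronous one. *)
apply: ereal_inf_lbound; exists (hr_coupling C tau x y).
  exact: hr_couplingP.
apply: expectation_hr_coupling.
- exact: measurable_sqr_mnorm_sub.
- apply: measurable_funB => //; exact: measurable_sqr_dotv_dir.
- by move=> z; exact: sqr_ge0.
- by move=> p; exact: sqr_mnorm_hr_step.
Qed.
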